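(* Let $n\in\mathbb{N}$, let $T_1,\dots,T_n\colon\mathbb{R}^d\to\mathbb{R}^d$ be mappings, let $\xi$ be a random variable taking values in $[n]=\{1,\dots,n\}$, and let $T(\bm{x}) := \mathbb{E}_\xi[T_\xi(\bm{x})]$ for $\bm{x}\in\mathbb{R}^d$. Assume that each $T_i$ is nonexpansive, that $\sigma\ge 0$ satisfies $\mathbb{E}_\xi[\|T_\xi(\bm{x})-T(\bm{x})\|^2]\le\sigma^2$ for all $\bm{x}\in\mathbb{R}^d$, and that $\mathrm{Fix}(T)\neq\emptyset$. Let $(\bm{x}_k)_{k\ge 0}$ be the sequence generated by the mini-batch stochastic Krasnosel'skii-Mann algorithm with initial point $\bm{x}_0\in\mathbb{R}^d$, step sizes $\alpha_k\in(0,1)$ and batch sizes $b_k\in\mathbb{N}$ satisfying $$\sum_{k=0}^{+\infty}\alpha_k(1-\alpha_k)=+\infty \quad\text{and}\quad \sum_{k=0}^{+\infty}\frac{1}{\sqrt{b_k}}<+\infty .$$ Then, for all $\bm{x}^\star\in\mathrm{Fix}(T)$ and all $K\in\mathbb{N}$ with $K\ge1$, $$\min_{k\in\{0,1,\dots,K-1\}}\mathbb{E}\left[\|\bm{x}_k-T(\bm{x}_k)\|\right]\le\frac{1}{\sqrt{\sum_{k=0}^{K-1}\alpha_k(1-\alpha_k)}}\sqrt{\|\bm{x}_0-\bm{x}^\star\|^2+\sigma^2\sum_{k=0}^{+\infty}\frac{\alpha_k}{b_k}} ,$$ and in particular $$\min_{k\in\{0,1,\dots,K-1\}}\mathbb{E}\left[\|\bm{x}_k-T(\bm{x}_k)\|\right]=O\left(\frac{1}{\sqrt{\sum_{k=0}^{K-1}\alpha_k(1-\alpha_k)}}\right)\quad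 (K\to+\infty).$$
   Context: $\mathbb{R}^d$ carries the Euclidean norm $\|\cdot\|$. A mapping $S\colon\mathbb{R}^d\to\mathbb{R}^d$ is nonexpansive if $\|S(\bm{x})-S(\bm{y})\|\le\|\bm{x}-\bm{y}\|$ for all $\bm{x},\bm{y}\in\mathbb{R}^d$. $\mathrm{Fix}(T):=\{\bm{x}\in\mathbb{R}^d : \bm{x}=T(\bm{x})\}$. For fixed $\bm{x}$, $\mathbb{E}_\xi[T_\xi(\bm{x})]=\sum_{i=1}^n T_i(\bm{x})\,\mathrm{P}(\xi=i)$; the distribution of $\xi$ on $[n]$ is arbitrary. $\mathbb{E}$ denotes the total expectation over all the samples $\bm{\xi}_0,\bm{\xi}_1,\dots$. Mini-batch stochastic Krasnosel'skii-Mann algorithm: given a deterministic initial point $\bm{x}_0\in\mathbb{R}^d$ and deterministic sequences $\alpha_k\in(0,1)$ (step sizes) and $b_k\in\mathbb{N}$, $b_k\ge1$ (batch sizes), for each $k=0,1,2,\dots$ draw $\bm{\xi}_k=(\xi_{k,1},\dots,\xi_{k,b_k})^\top$ consisting of $b_k$ i.i.d. copies of $\xi$ (sampling with replacement), with $\bm{\xi}_0,\bm{\xi}_1,\dots$ independent, and set $$T_{\bm{\xi}_k}(\bm{x}_k):=\frac{1}{b_k}\sum_{i=1}^{b_k}T_{\xi_{k,i}}(\bm{x}_k),\qquad \bm{x}_{k+1}:=(1-\alpha_k)\bm{x}_k+\alpha_k T_{\bm{\xi}_k}(\bm{x}_k).$$ *)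

(* Defs.v *)
From HB Require Import structures.
From mathcomp Require Import all_boot all_order all_algebra finmap.
From mathcomp Require Import all_classical all_reals all_analysis.

Set Implicit Arguments.
Unset Strict Implicit.
Unset Printing Implicit Defensive.

Import Order.TTheory GRing.Theory Num.Theory.
Import numFieldNormedType.Exports.

Local Open Scope classical_set_scope.
Local Open Scope ring_scope.

(* The library norm on 'rV[R]_d is the sup norm, hence this definition. *)
Definition enorm (R : realType) (d : nat) (x : 'rV[R]_d) : R :=
  Num.sqrt (\sum_(j < d) x 0 j ^+ 2).

Definition nonexpansive (R : realType) (d : nat)
    (S : 'rV[R]_d -> 'rV[R]_d) : Prop :=
  forall x y, enorm (S x - S y) <= enorm (x - y).

Definition Fix (R : realType) (d : nat) (S : 'rV[R]_d -> 'rV[R]_d) :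
  set 'rV[R]_d := [set x | x = S x].

(* Countable types carry the discrete sigma-algebra: in the next three
   definitions, every subset of the codomain is an admissible event. *)
Definition discrete_rv (disp : measure_display) (Omega : measurableType disp)
    (E : countType) (X : Omega -> E) : Prop :=
  forall A : set E, measurable (X @^-1` A).

Definition same_law (R : realType)
    (disp : measure_display) (Omega : measurableType disp)
    (P : probability Omega R)
    (disp' : measure_display) (Omega' : measurableType disp')
    (P' : probability Omega' R)
    (E : countType) (X : Omega -> E) (Y : Omega' -> E) : Prop :=
  forall A : set E, P (X @^-1` A) = P' (Y @^-1` A).

Definition mutually_independent (R : realType)
    (disp : measure_display) (Omega : measurableType disp)
    (P : probability Omega R)
    (I : choiceType) (E : I -> countType) (X : forall i, Omega -> E i) : Prop :=
  forall (J : {fset I}) (A : forall i, set (E i)),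
    P (\bigcap_(i in [set` J]) (X i @^-1` A i)) =
    (\prod_(i <- J) P (X i @^-1` A i))%E.

(* E_xi [T_xi x], a finite sum since xi takes values in 'I_n. *)
Definition mean_op (R : realType) (d n : nat)
    (disp : measure_display) (Omega : measurableType disp)
    (P : probability Omega R) (xi : Omega -> 'I_n)
    (Ti : 'I_n -> 'rV[R]_d -> 'rV[R]_d) (x : 'rV[R]_d) : 'rV[R]_d :=
  \sum_(i < n) fine (P (xi @^-1` [set i])) *: Ti i x.

Definition batch_op (R : realType) (d n : nat)
    (Ti : 'I_n -> 'rV[R]_d -> 'rV[R]_d) (m : nat) (s : m.-tuple 'I_n)
    (x : 'rV[R]_d) : 'rV[R]_d :=
  m%:R^-1 *: \sum_(i < m) Ti (tnth s i) x.

(* xi k is the k-th batch (xi_{k,1}, ..., xi_{k,b_k}). *)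
Fixpoint minibatch_KM (R : realType) (d n : nat) (Omega : Type)
    (Ti : 'I_n -> 'rV[R]_d -> 'rV[R]_d) (x0 : 'rV[R]_d)
    (alpha : nat -> R) (b : nat -> nat)
    (xi : forall k, Omega -> (b k).-tuple 'I_n)
    (k : nat) (w : Omega) : 'rV[R]_d :=
  if k is k'.+1 then
    let x := minibatch_KM Ti x0 alpha xi k' w in
    (1 - alpha k') *: x + alpha k' *: batch_op Ti (xi k' w) x
  else x0.

(* Samples within a batch are i.i.d. copies of zeta, and the batches are
   independent of each other. *)
Definition minibatch_sampling (R : realType) (n : nat)
    (disp0 : measure_display) (Omega0 : measurableType disp0)
    (P0 : probability Omega0 R) (zeta : Omega0 -> 'I_n)
    (disp : measure_display) (Omega : measurableType disp)
    (P : probability Omega R)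
    (b : nat -> nat) (xi : forall k, Omega -> (b k).-tuple 'I_n) : Prop :=
  [/\ forall k, discrete_rv (xi k),
      forall k (i : 'I_(b k)), same_law P P0 (fun w => tnth (xi k w) i) zeta,
      forall k,
        mutually_independent P (fun (i : 'I_(b k)) w => tnth (xi k w) i)
    & mutually_independent P xi].

(* E ||x - T x|| for a random point x. *)
Definition expected_residual (R : realType) (d : nat)
    (disp : measure_display) (Omega : measurableType disp)
    (P : probability Omega R)
    (T : 'rV[R]_d -> 'rV[R]_d) (x : Omega -> 'rV[R]_d) : \bar R :=
  'E_P[fun w => enorm (x w - T (x w))].

(* Main.v *)
Require Import Defs.
From HB Require Import structures.
From mathcomp Require Import all_boot all_order all_algebra finmap.
From mathcomp Require Import all_classical all_reals all_analysis.
From mathcomp Require Import ring lra.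

Set Implicit Arguments.
Unset Strict Implicit.
Unset Printing Implicit Defensive.

Import Order.TTheory GRing.Theory Num.Theory.
Import numFieldNormedType.Exports.

Local Open Scope classical_set_scope.
Local Open Scope ring_scope.

(** The classical argument is a stochastic Fejer inequality.  Fix a fixed
    point z of T and put e_k := E||x_k - z||^2.  The identity
      ||(1 - a) x + a y - z||^2
        = (1 - a) ||x - z||^2 + a ||y - z||^2 - a (1 - a) ||x - y||^2
    is applied with y the batch average at x.  Conditionally on x, this average
    has mean T x and variance at most sigma^2 / b, because the samples of a
    batch are pairwise independent.  Bias-variance decompositions around z and
    around x, together with ||T x - z|| <= ||x - z||, then give
      e_{k+1} <= e_k - alpha_k (1 - alpha_k) E||x_k - T x_k||^2
                 + sigma^2 alpha_k / b_k                  [KM_mean_descent].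
    Summing over k < K telescopes, and since
    (E||x_k - T x_k||)^2 <= E||x_k - T x_k||^2, some k < K satisfies the claimed
    bound [descent_small_residual].  The O-statement follows because
    alpha_k / b_k <= 1 / sqrt b_k makes the noise series converge.

    No general conditional expectation is involved.  Everything random is a
    function of finitely many samples with values in a finite set, so every
    expectation is a finite sum against a law [expectation_law], and
    conditioning on the past is the factorisation of the law of the first k + 1
    batches as the law of the first k batches times that of batch k
    [law_history].  The descent only sees squared norms, handled coordinatewise,
    so that Jensen's inequality replaces the triangle inequality. *)

(** * Random variables with values in a finite type *)

Definition law {R : realType} {disp : measure_display}
    {Omega : measurableType disp} (P : probability Omega R) {S : finType}
    (X : Omega -> S) (s : S) : R := fine (P (X @^-1` [set s])).

Lemma law_ge0 (R : realType) (disp : measure_display)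
    (Omega : measurableType disp) (P : probability Omega R) (S : finType)
    (X : Omega -> S) (s : S) : 0 <= law P X s.
Proof. exact: fine_ge0. Qed.

(** The function f o X is the linear combination of the indicators of the
    events X = s with coefficients f s. *)
Lemma expectation_law (R : realType) (disp : measure_display)
    (Omega : measurableType disp) (P : probability Omega R) (S : finType)
    (X : Omega -> S) (f : S -> R) :
  discrete_rv X ->
  ('E_P[fun w => f (X w)] = (\sum_s law P X s * f s)%:E)%E.
Proof.
move=> mX; rewrite unlock.
have int1 s : P.-integrable setT (EFin \o \1_(X @^-1` [set s])).
  exact: integrable_indic.
under eq_integral => w _.
  rewrite (_ : (f (X w))%:E =
    \sum_s ((f s)%:E * (\1_(X @^-1` [set s]) w)%:E)%E); last first.
    rewrite (bigD1 (X w))//= indicE mem_set// mule1 big1 ?adde0// => s sX.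
    by rewrite indicE memNset ?mule0//= => /esym/eqP; rewrite (negPf sX).
  over.
rewrite integral_sum//; last first.
  by move=> s; apply: integrableZl => //; exact: int1.
rewrite -sumEFin; apply: eq_bigr => s _.
rewrite (integralZl _ (int1 s))// integral_indic// setIT EFinM muleC.
rewrite /law fineK//.
by apply: fin_num_measure; exact: mX.
Qed.

Lemma sum_law (R : realType) (disp : measure_display)
    (Omega : measurableType disp) (P : probability Omega R) (S : finType)
    (X : Omega -> S) :
  discrete_rv X -> \sum_s law P X s = 1.
Proof.
move=> mX; have := expectation_law P (fun=> 1) mX.
rewrite [LHS](expectation_cst P 1) => -[->].
by apply: eq_bigr => s _; rewrite mulr1.
Qed.

Lemma discrete_rv_comp (disp : measure_display) (Omega : measurableType disp)
    (S S' : countType) (X : Omega -> S) (g : S -> S') :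
  discrete_rv X -> discrete_rv (g \o X).
Proof. by move=> mX A; rewrite comp_preimage; exact: mX. Qed.

(** Both sides are the expectation of f o g o X, computed through X and through
    g o X; this is how marginals of a law are taken. *)
Lemma sum_law_comp (R : realType) (disp : measure_display)
    (Omega : measurableType disp) (P : probability Omega R) (S S' : finType)
    (X : Omega -> S) (g : S -> S') (f : S' -> R) :
  discrete_rv X ->
  \sum_s law P X s * f (g s) = \sum_t law P (g \o X) t * f t.
Proof.
move=> mX; apply: EFin_inj; rewrite -(expectation_law P (f \o g) mX).
exact: (expectation_law P f (discrete_rv_comp g mX)).
Qed.

Lemma discrete_rv_pair (disp : measure_display) (Omega : measurableType disp)
    (S S' : finType) (X : Omega -> S) (Y : Omega -> S') :
  discrete_rv X -> discrete_rv Y -> discrete_rv (fun w => (X w, Y w)).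
Proof.
move=> mX mY A.
rewrite (_ : _ @^-1` A =
  \bigcup_(st in A) (X @^-1` [set st.1] `&` Y @^-1` [set st.2])); last first.
  apply/seteqP; split=> [w Aw|w [[s t]/= Ast [/= -> ->]]//].
  by exists (X w, Y w).
apply: fin_bigcup_measurable; first exact: finite_finset.
by move=> st _; apply: measurableI; [exact: mX|exact: mY].
Qed.

Lemma law_pair (R : realType) (disp : measure_display)
    (Omega : measurableType disp) (P : probability Omega R) (S S' : finType)
    (X : Omega -> S) (Y : Omega -> S') (s : S) (t : S') :
  discrete_rv X -> discrete_rv Y ->
  P (X @^-1` [set s] `&` Y @^-1` [set t]) =
    (P (X @^-1` [set s]) * P (Y @^-1` [set t]))%E ->
  law P (fun w => (X w, Y w)) (s, t) = law P X s * law P Y t.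
Proof.
move=> mX mY indep; rewrite /law -fineM ?fin_num_measure// -indep.
by congr (fine (P _)); apply/seteqP; split=> [w [<- <-]|w [/= -> ->]].
Qed.

(** * Independence of pairs and of the past *)

(** Constraining the components outside i and j by setT reduces the pair to a
    product event over the two-element index set. *)
Lemma mutually_independent_pair (R : realType) (disp : measure_display)
    (Omega : measurableType disp) (P : probability Omega R) (I : choiceType)
    (E : I -> countType) (X : forall i, Omega -> E i) (i j : I)
    (A : set (E i)) (B : set (E j)) :
  mutually_independent P X -> i != j ->
  P (X i @^-1` A `&` X j @^-1` B) = (P (X i @^-1` A) * P (X j @^-1` B))%E.
Proof.
move=> indX ij.
pose C := dfwith (dfwith (fun k => setT : set (E k)) i A) j B.
have Cj : C j = B by exact: dfwithin.
have Ci : C i = A by rewrite /C dfwithout 1?eq_sym// dfwithin.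
have := indX [fset i; j]%fset C.
rewrite big_fsetU1 ?inE//= big_seq_fset1 Ci Cj => <-; congr (P _).
apply/seteqP; split=> [w [Aw Bw] k /=|w h].
  by rewrite !inE => /orP[|] /eqP ->; rewrite ?Ci ?Cj.
split; first by rewrite -Ci; apply: h; rewrite /= !inE eqxx.
by rewrite -Cj; apply: h; rewrite /= !inE eqxx orbT.
Qed.

(** The events that constrain the first k variables separately.  Each value of
    the history of the algorithm is such an event. *)
Definition cylinder {Omega : Type} {E : nat -> countType}
    (X : forall k, Omega -> E k) (A : forall k, set (E k)) (k : nat) :
  set Omega := \bigcap_(j in [set j | (j < k)%N]) (X j @^-1` A j).

Lemma cylinder_dfwith (Omega : Type) (E : nat -> countType)
    (X : forall k, Omega -> E k) (A : forall k, set (E k)) (k : nat)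
    (B : set (E k)) :
  cylinder X (dfwith A k B) k.+1 = cylinder X A k `&` X k @^-1` B.
Proof.
have out j : (j < k)%N -> dfwith A k B j = A j.
  by move=> jk; rewrite dfwithout// gtn_eqF.
apply/seteqP; split=> [w h|w [hA hB] j /=].
  split=> [j /= jk|]; last first.
    by have := h k (ltnSn k); rewrite /preimage/= dfwithin.
  by have := h j (ltnW jk); rewrite /preimage/= out.
rewrite ltnS leq_eqVlt => /orP[/eqP ->|jk]; first by rewrite dfwithin.
by rewrite /preimage/= out//; exact: hA.
Qed.

(** Both sides are products over initial segments of nat: intersecting a
    cylinder with an event on X k only overwrites the k-th constraint. *)
Lemma cylinder_indep (R : realType) (disp : measure_display)
    (Omega : measurableType disp) (P : probability Omega R)
    (E : nat -> countType) (X : forall k, Omega -> E k)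
    (A : forall k, set (E k)) (k : nat) (B : set (E k)) :
  mutually_independent P X ->
  P (cylinder X A k `&` X k @^-1` B) =
    (P (cylinder X A k) * P (X k @^-1` B))%E.
Proof.
move=> indX.
(* The finite index set used for independence is {0, ..., m - 1}. *)
have Pcyl C m : P (cylinder X C m) = (\prod_(j < m) P (X j @^-1` C j))%E.
  have := indX [fset j in iota 0 m]%fset C.
  rewrite (_ : \bigcap_(i in _) _ = cylinder X C m); last first.
    by rewrite /cylinder; congr (bigcap _ _); apply/seteqP; split=> j /=;
      rewrite !inE mem_iota.
  move=> ->; rewrite -(big_mkord xpredT (fun j => P (X j @^-1` C j))).
  rewrite /index_iota subn0; apply: perm_big; apply: uniq_perm => [||j].
  - exact: fset_uniq.
  - exact: iota_uniq.
  - by rewrite !inE.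
rewrite -cylinder_dfwith !Pcyl big_ord_recr/= dfwithin; congr (_ * _)%E.
by apply: eq_bigr => j _; rewrite dfwithout// gtn_eqF.
Qed.

(** * Squared norms and weighted means *)

Lemma enorm_sqr (R : realType) (d : nat) (x : 'rV[R]_d) :
  enorm x ^+ 2 = \sum_(j < d) x 0 j ^+ 2.
Proof. by rewrite sqr_sqrtr// sumr_ge0// => j _; exact: sqr_ge0. Qed.

(** The negative last term is the source of the whole convergence rate. *)
Lemma relaxation_identity (R : realType) (d : nat) (a : R)
    (x y z : 'rV[R]_d) :
  enorm ((1 - a) *: x + a *: y - z) ^+ 2 =
    (1 - a) * enorm (x - z) ^+ 2 + a * enorm (y - z) ^+ 2
    - a * (1 - a) * enorm (x - y) ^+ 2.
Proof.
rewrite !enorm_sqr !mulr_sumr -sumrN -!big_split/=; apply: eq_bigr => j _.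
by rewrite !mxE; ring.
Qed.

(** Expanding (u - c)^2 around the mean m leaves the cross term
    2 (m - c) (u - m), whose weighted sum is zero. *)
Lemma weighted_bias_variance (R : realType) (S : finType) (w u : S -> R)
    (c : R) :
  \sum_s w s = 1 ->
  \sum_s w s * (u s - c) ^+ 2 =
    (\sum_s w s * u s - c) ^+ 2
    + \sum_s w s * (u s - \sum_s w s * u s) ^+ 2.
Proof.
move=> w1; set m := \sum_s w s * u s.
under eq_bigr => s _.
  rewrite (_ : w s * _ = w s * (u s - m) ^+ 2 + 2 * (m - c) * (w s * u s)
    + (c ^+ 2 - m ^+ 2) * w s); last by ring.
  over.
by rewrite !big_split/= -!mulr_sumr -/m w1; ring.
Qed.

(** Second moment minus squared mean is a variance: take c = 0 in the
    bias-variance decomposition. *)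
Lemma jensen_sqr (R : realType) (S : finType) (w u : S -> R) :
  (forall s, 0 <= w s) -> \sum_s w s = 1 ->
  (\sum_s w s * u s) ^+ 2 <= \sum_s w s * u s ^+ 2.
Proof.
move=> w0 /(weighted_bias_variance u 0); rewrite subr0.
under eq_bigr do rewrite subr0.
move=> ->; rewrite lerDl sumr_ge0// => s _.
by rewrite mulr_ge0// sqr_ge0.
Qed.

Lemma bias_variance (R : realType) (d : nat) (S : finType) (w : S -> R)
    (v : S -> 'rV[R]_d) (z : 'rV[R]_d) :
  \sum_s w s = 1 ->
  \sum_s w s * enorm (v s - z) ^+ 2 =
    enorm (\sum_s w s *: v s - z) ^+ 2
    + \sum_s w s * enorm (v s - \sum_s w s *: v s) ^+ 2.
Proof.
move=> w1.
have swap y : \sum_s w s * enorm (v s - y) ^+ 2 =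
    \sum_(j < d) \sum_s w s * (v s 0 j - y 0 j) ^+ 2.
  rewrite exchange_big; apply: eq_bigr => s _; rewrite enorm_sqr mulr_sumr.
  by apply: eq_bigr => j _; rewrite !mxE.
rewrite !swap enorm_sqr -big_split/=; apply: eq_bigr => j _.
have E : (\sum_s w s *: v s) 0 j = \sum_s w s * v s 0 j.
  by rewrite summxE; apply: eq_bigr => s _; rewrite mxE.
by rewrite weighted_bias_variance// mxE [in RHS]mxE E.
Qed.

Lemma jensen_enorm_sqr (R : realType) (d : nat) (S : finType) (w : S -> R)
    (v : S -> 'rV[R]_d) :
  (forall s, 0 <= w s) -> \sum_s w s = 1 ->
  enorm (\sum_s w s *: v s) ^+ 2 <= \sum_s w s * enorm (v s) ^+ 2.
Proof.
move=> w0 /(bias_variance v 0); rewrite subr0.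
under eq_bigr do rewrite subr0.
move=> ->; rewrite lerDl sumr_ge0// => s _.
by rewrite mulr_ge0// sqr_ge0.
Qed.

(** * Moments of a batch average *)

Lemma sum_iid_mean (R : realType) (n m : nat) (disp : measure_display)
    (Omega : measurableType disp) (P : probability Omega R)
    (Y : Omega -> m.-tuple 'I_n) (p u : 'I_n -> R) :
  discrete_rv Y ->
  (forall i a, law P (fun w => tnth (Y w) i) a = p a) ->
  \sum_s law P Y s * (\sum_(i < m) u (tnth s i)) =
    m%:R * \sum_a p a * u a.
Proof.
move=> mY Yp; under eq_bigr do rewrite mulr_sumr.
rewrite exchange_big/= (eq_bigr (fun=> \sum_a p a * u a)).
  by rewrite sumr_const card_ord mulr_natl.
move=> i _; rewrite (sum_law_comp P (fun s => tnth s i) u mY).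
by apply: eq_bigr => a _; congr (_ * _); exact: Yp.
Qed.

(** For centred u the off-diagonal terms of the expanded square vanish by
    pairwise independence, and the m diagonal terms are equal. *)
Lemma sum_iid_sqr (R : realType) (n m : nat) (disp : measure_display)
    (Omega : measurableType disp) (P : probability Omega R)
    (Y : Omega -> m.-tuple 'I_n) (p u : 'I_n -> R) :
  discrete_rv Y ->
  (forall i a, law P (fun w => tnth (Y w) i) a = p a) ->
  mutually_independent P (fun (i : 'I_m) w => tnth (Y w) i) ->
  \sum_a p a * u a = 0 ->
  \sum_s law P Y s * (\sum_(i < m) u (tnth s i)) ^+ 2 =
    m%:R * \sum_a p a * u a ^+ 2.
Proof.
move=> mY Yp indY u0.
have mYi i : discrete_rv (fun w => tnth (Y w) i).
  exact: (discrete_rv_comp (fun s => tnth s i) mY).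
under eq_bigr do rewrite expr2 big_distrlr/= mulr_sumr.
rewrite exchange_big/= (eq_bigr (fun=> \sum_a p a * u a ^+ 2)).
  by rewrite sumr_const card_ord mulr_natl.
move=> i _; under eq_bigr do rewrite mulr_sumr.
rewrite exchange_big/= (bigD1 i)//= [X in _ + X]big1 ?addr0.
  rewrite (sum_law_comp P (fun s => tnth s i) (fun a => u a * u a) mY).
  by apply: eq_bigr => a _; rewrite -expr2; congr (_ * _); exact: Yp.
move=> j ji.
rewrite (sum_law_comp P (fun s => (tnth s i, tnth s j))
  (fun ac => u ac.1 * u ac.2) mY).
transitivity (\sum_ac (p ac.1 * u ac.1) * (p ac.2 * u ac.2)).
  apply: eq_bigr => -[a c] _ /=; rewrite mulrACA; congr (_ * _).
  rewrite -(Yp i) -(Yp j); apply: law_pair => //.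
  by apply: (mutually_independent_pair _ _ indY); rewrite eq_sym.
rewrite -(pair_bigA _ (fun a c => (p a * u a) * (p c * u c)))/=.
by rewrite big1// => a _; rewrite -mulr_sumr u0 mulr0.
Qed.

Lemma batch_op_mean (R : realType) (d n m : nat) (disp : measure_display)
    (Omega : measurableType disp) (P : probability Omega R)
    (Y : Omega -> m.-tuple 'I_n) (p : 'I_n -> R)
    (Ti : 'I_n -> 'rV[R]_d -> 'rV[R]_d) (x : 'rV[R]_d) :
  (0 < m)%N -> discrete_rv Y ->
  (forall i a, law P (fun w => tnth (Y w) i) a = p a) ->
  \sum_s law P Y s *: batch_op Ti s x = \sum_a p a *: Ti a x.
Proof.
move=> m0 mY Yp; apply/rowP => j; rewrite !summxE.
under eq_bigr => s _ do rewrite !mxE summxE mulrCA.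
rewrite -mulr_sumr (sum_iid_mean (fun a => Ti a x 0 j) mY Yp).
rewrite mulKf ?pnatr_eq0 ?lt0n_neq0//.
by apply: eq_bigr => a _; rewrite mxE.
Qed.

(** Averaging m samples divides the variance by m: [sum_iid_sqr] is applied to
    each coordinate of Ti a x - y, centred since y is the mean. *)
Lemma batch_op_variance (R : realType) (d n m : nat) (disp : measure_display)
    (Omega : measurableType disp) (P : probability Omega R)
    (Y : Omega -> m.-tuple 'I_n) (p : 'I_n -> R)
    (Ti : 'I_n -> 'rV[R]_d -> 'rV[R]_d) (x : 'rV[R]_d) :
  (0 < m)%N -> discrete_rv Y ->
  (forall i a, law P (fun w => tnth (Y w) i) a = p a) -> \sum_a p a = 1 ->
  mutually_independent P (fun (i : 'I_m) w => tnth (Y w) i) ->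
  let y := \sum_a p a *: Ti a x in
  \sum_s law P Y s * enorm (batch_op Ti s x - y) ^+ 2 =
    m%:R^-1 * \sum_a p a * enorm (Ti a x - y) ^+ 2.
Proof.
move=> m0 mY Yp p1 indY y.
have mR0 : m%:R != 0 :> R by rewrite pnatr_eq0 lt0n_neq0.
under eq_bigr do rewrite enorm_sqr mulr_sumr.
under [in RHS]eq_bigr do rewrite enorm_sqr mulr_sumr.
rewrite exchange_big [in RHS]exchange_big/= mulr_sumr; apply: eq_bigr => j _.
pose u a := Ti a x 0 j - y 0 j.
have u0 : \sum_a p a * u a = 0.
  under eq_bigr do rewrite mulrBr.
  rewrite sumrB -mulr_suml p1 mul1r; apply/eqP; rewrite subr_eq0; apply/eqP.
  by rewrite summxE; apply: eq_bigr => a _; rewrite mxE.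
transitivity (m%:R^-1 ^+ 2 *
    \sum_s law P Y s * (\sum_(i < m) u (tnth s i)) ^+ 2).
  rewrite mulr_sumr; apply: eq_bigr => s _; rewrite [RHS]mulrCA -exprMn.
  congr (_ * _ ^+ 2); rewrite !mxE summxE sumrB sumr_const card_ord.
  by rewrite mulrBr -[y 0 j *+ m]mulr_natl mulKf.
rewrite (sum_iid_sqr mY Yp indY u0) expr2 -mulrA mulKf//.
by congr (_ * _); apply: eq_bigr => a _; rewrite !mxE.
Qed.
Lemma enorm_distC (R : realType) (d : nat) (x y : 'rV[R]_d) :
  enorm (x - y) = enorm (y - x).
Proof.
by congr Num.sqrt; apply: eq_bigr => j _; rewrite !mxE -sqrrN opprB.
Qed.

(** * Descent in one relaxed step *)

(** Jensen for the squared norm applied to the differences Ti a x - Ti a y. *)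
Lemma mean_op_nonexpansive (R : realType) (d n : nat)
    (disp : measure_display) (Omega : measurableType disp)
    (P : probability Omega R) (zeta : Omega -> 'I_n)
    (Ti : 'I_n -> 'rV[R]_d -> 'rV[R]_d) :
  discrete_rv zeta -> (forall i, nonexpansive (Ti i)) ->
  nonexpansive (mean_op P zeta Ti).
Proof.
move=> mzeta neTi x y.
rewrite -(@ler_pXn2r _ 2) ?nnegrE ?sqrtr_ge0// /mean_op -sumrB.
under eq_bigr do rewrite -scalerBr.
apply: le_trans (jensen_enorm_sqr _ _ (sum_law P mzeta)) _.
  by move=> a; exact: law_ge0.
rewrite -[leRHS]mul1r -(sum_law P mzeta) mulr_suml ler_sum// => a _.
by rewrite ler_wpM2l ?law_ge0// ler_pXn2r ?nnegrE ?sqrtr_ge0//; exact: neTi.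
Qed.

(** The variance v of B enters twice: with factor a through ||B - z||^2 and
    with factor - a (1 - a) through ||x - B||^2.  Only a V is kept of the
    resulting bound a^2 v, which is what makes the final constant involve
    alpha_k / b_k. *)
Lemma relaxed_step_descent (R : realType) (d : nat) (S : finType)
    (w : S -> R) (B : S -> 'rV[R]_d) (a V : R) (x z : 'rV[R]_d) :
  (forall s, 0 <= w s) -> \sum_s w s = 1 -> 0 < a < 1 ->
  let y := \sum_s w s *: B s in
  enorm (y - z) <= enorm (x - z) ->
  \sum_s w s * enorm (B s - y) ^+ 2 <= V ->
  \sum_s w s * enorm ((1 - a) *: x + a *: B s - z) ^+ 2 <=
    enorm (x - z) ^+ 2 - a * (1 - a) * enorm (x - y) ^+ 2 + a * V.
Proof.
move=> w0 w1 /andP[a0 a1] y yz.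
have /(_ z) bvz := bias_variance B _ w1.
have /(_ x) bvx := bias_variance B _ w1.
move: bvz bvx; rewrite -/y; set v := \sum_s _ * enorm (_ - y) ^+ 2.
move=> bvz bvx vV.
under eq_bigr => s _.
  rewrite relaxation_identity (enorm_distC x (B s)).
  rewrite (_ : w s * _ = (1 - a) * enorm (x - z) ^+ 2 * w s
    + a * (w s * enorm (B s - z) ^+ 2)
    - a * (1 - a) * (w s * enorm (B s - x) ^+ 2)); last by ring.
  over.
rewrite sumrB big_split/= -!mulr_sumr w1 bvz bvx (enorm_distC x y).
have v0 : 0 <= v.
  by rewrite sumr_ge0// => s _; rewrite mulr_ge0// sqr_ge0.
have yz2 : enorm (y - z) ^+ 2 <= enorm (x - z) ^+ 2.
  by rewrite ler_pXn2r ?nnegrE ?sqrtr_ge0.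
have h1 : a * enorm (y - z) ^+ 2 <= a * enorm (x - z) ^+ 2.
  by rewrite ler_pM2l.
have h2 : a * v <= a * V by rewrite ler_pM2l.
have h3 : 0 <= a * (1 - a) * v.
  by rewrite mulr_ge0// mulr_ge0 ?subr_ge0 ?ltW.
lra.
Qed.

(** * The algorithm as a function of a finite history *)

(** Past batches as nested pairs, most recent last: batch sizes vary with k, and
    the type has to be finite for expectations to be finite sums. *)
Fixpoint history_type (n : nat) (b : nat -> nat) (k : nat) : finType :=
  if k is k'.+1 then (history_type n b k' * (b k').-tuple 'I_n)%type
  else unit.

Fixpoint history {n : nat} {b : nat -> nat} {Omega : Type}
    (xi : forall k, Omega -> (b k).-tuple 'I_n) (k : nat) (w : Omega) :
    history_type n b k :=
  match k with
  | 0 => tt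
  | k'.+1 => (history xi k' w, xi k' w)
  end.

(** The recursion of [minibatch_KM] read on a fixed realisation of the batches,
    so that x_k is this deterministic function of the history. *)
Fixpoint KM_of_history {R : realType} {d n : nat}
    (Ti : 'I_n -> 'rV[R]_d -> 'rV[R]_d) (x0 : 'rV[R]_d) (alpha : nat -> R)
    (b : nat -> nat) (k : nat) : history_type n b k -> 'rV[R]_d :=
  match k with
  | 0 => fun=> x0
  | k'.+1 => fun hs =>
      let x := KM_of_history Ti x0 alpha hs.1 in
      (1 - alpha k') *: x + alpha k' *: batch_op Ti hs.2 x
  end.

Lemma minibatch_KM_history (R : realType) (d n : nat) (Omega : Type)
    (Ti : 'I_n -> 'rV[R]_d -> 'rV[R]_d) (x0 : 'rV[R]_d) (alpha : nat -> R)
    (b : nat -> nat) (xi : forall k, Omega -> (b k).-tuple 'I_n) (k : nat)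
    (w : Omega) :
  minibatch_KM Ti x0 alpha xi k w =
    KM_of_history Ti x0 alpha (history xi k w).
Proof. by elim: k => //= k ->. Qed.

Lemma discrete_rv_history (n : nat) (b : nat -> nat)
    (disp : measure_display) (Omega : measurableType disp)
    (xi : forall k, Omega -> (b k).-tuple 'I_n) (k : nat) :
  (forall k, discrete_rv (xi k)) -> discrete_rv (history xi k).
Proof.
move=> mxi; elim: k => [A|k IH]; last exact: (discrete_rv_pair IH (mxi k)).
have [Att|Att] := pselect (A tt).
  by rewrite (_ : _ @^-1` _ = setT)//; apply/seteqP; split.
by rewrite (_ : _ @^-1` _ = set0)//; apply/seteqP; split.
Qed.

Lemma history_cylinder (n : nat) (b : nat -> nat) (Omega : Type)
    (xi : forall k, Omega -> (b k).-tuple 'I_n) (k : nat)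
    (h : history_type n b k) :
  exists A : forall j, set ((b j).-tuple 'I_n),
    history xi k @^-1` [set h] = cylinder xi A k.
Proof.
elim: k h => [[]|k IH [h s]].
  by exists (fun=> setT); apply/seteqP; split.
have [A hA] := IH h; exists (dfwith A k [set s]).
rewrite (cylinder_dfwith xi) -hA.
by apply/seteqP; split=> [w [<- <-]|w [/= -> ->]].
Qed.

(** Batch k is independent of the past: the transition from k to k + 1 is an
    average over a fresh batch with the current point held fixed. *)
Lemma law_history (R : realType) (n : nat) (b : nat -> nat)
    (disp : measure_display) (Omega : measurableType disp)
    (P : probability Omega R) (xi : forall k, Omega -> (b k).-tuple 'I_n)
    (k : nat) (h : history_type n b k) (s : (b k).-tuple 'I_n) :
  (forall k, discrete_rv (xi k)) -> mutually_independent P xi ->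
  law P (history xi k.+1) (h, s) = law P (history xi k) h * law P (xi k) s.
Proof.
move=> mxi indxi; have [A hA] := history_cylinder xi h.
apply: (law_pair (discrete_rv_history mxi) (mxi k)).
by rewrite hA; exact: cylinder_indep.
Qed.

(** * Convergence rate *)

(** The steps telescope to sum_k a_k r_k^2 <= D, where D is e_0 plus the total
    noise.  With S the sum of the weights, t = sqrt D / sqrt S satisfies
    S t^2 = D, so r_k > t cannot hold for every k < K. *)
Lemma descent_small_residual (R : realType) (e r a c : nat -> R) (K : nat) :
  (0 < K)%N -> (forall k, 0 < a k) -> (forall k, 0 <= e k) ->
  (forall k, e k.+1 <= e k - a k * r k ^+ 2 + c k) ->
  exists2 k, (k < K)%N &
    r k <= (Num.sqrt (\sum_(0 <= k < K) a k))^-1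
           * Num.sqrt (e 0 + \sum_(0 <= k < K) c k).
Proof.
move=> K0 a0 e0 step.
set S := \sum_(0 <= k < K) a k; set D := e 0 + _; set t := _ * _.
have tele m : \sum_(0 <= k < m) a k * r k ^+ 2 <=
    e 0 - e m + \sum_(0 <= k < m) c k.
  elim: m => [|m IH]; first by rewrite !big_geq// subrr addr0.
  by rewrite !big_nat_recr//=; have := step m; lra.
have DK : \sum_(0 <= k < K) a k * r k ^+ 2 <= D.
  by apply: le_trans (tele K) _; rewrite /D; have := e0 K; lra.
have S0 : 0 < S.
  rewrite /S big_mkord (bigD1 (Ordinal K0))//= ltr_pwDl// sumr_ge0// => i _.
  exact: ltW.
have D0 : 0 <= D.
  by apply: le_trans DK; rewrite sumr_ge0// => k _;
    rewrite mulr_ge0 ?sqr_ge0// ltW.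
have tD : S * t ^+ 2 = D.
  rewrite exprMn exprVn !sqr_sqrtr// ?(ltW S0)// mulVKf//.
  by rewrite gt_eqF.
have t0 : 0 <= t by rewrite mulr_ge0 ?invr_ge0 ?sqrtr_ge0.
apply: contrapT => none.
suff : \sum_(0 <= k < K) a k * t ^+ 2 < \sum_(0 <= k < K) a k * r k ^+ 2.
  by rewrite -mulr_suml -/S tD ltNge DK.
apply: ltr_sum_nat => // k /andP[_ kK].
have tr : t < r k by rewrite ltNge; apply/negP => rt; apply: none; exists k.
by rewrite ltr_pM2l// ltr_pXn2r ?nnegrE// ltW// (le_lt_trans t0).
Qed.

(** The one-step descent at a frozen point x, averaged over the past by
    [law_history].  The additive noise term is constant in the past, hence
    survives the averaging unchanged. *)
Lemma KM_mean_descent (R : realType) (d n : nat)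
    (Ti : 'I_n -> 'rV[R]_d -> 'rV[R]_d)
    (disp0 : measure_display) (Omega0 : measurableType disp0)
    (P0 : probability Omega0 R) (zeta : Omega0 -> 'I_n)
    (T : 'rV[R]_d -> 'rV[R]_d) (sigma : R) (x0 z : 'rV[R]_d)
    (alpha : nat -> R) (b : nat -> nat)
    (disp : measure_display) (Omega : measurableType disp)
    (P : probability Omega R)
    (xi : forall k, Omega -> (b k).-tuple 'I_n) (k : nat) :
  discrete_rv zeta -> (forall x, T x = mean_op P0 zeta Ti x) ->
  (forall i, nonexpansive (Ti i)) ->
  (forall x, ('E_P0[fun w => (enorm (Ti (zeta w) x - T x) ^+ 2)%R]
     <= (sigma ^+ 2)%:E)%E) ->
  Fix T z -> 0 < alpha k < 1 -> (0 < b k)%N ->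
  minibatch_sampling P0 zeta P xi ->
  \sum_h law P (history xi k.+1) h
      * enorm (KM_of_history Ti x0 alpha h - z) ^+ 2 <=
    \sum_h law P (history xi k) h
      * enorm (KM_of_history Ti x0 alpha h - z) ^+ 2
    - alpha k * (1 - alpha k) * \sum_h law P (history xi k) h
      * enorm (KM_of_history Ti x0 alpha h - T (KM_of_history Ti x0 alpha h)) ^+ 2
    + sigma ^+ 2 * (alpha k / (b k)%:R).
Proof.
move=> mzeta TE neTi var zfix ak bk [mxi xiz indb indxi].
pose X j := @KM_of_history _ _ _ Ti x0 alpha b j.
have neT x : enorm (T x - z) <= enorm (x - z).
  by rewrite {1}zfix !TE; exact: mean_op_nonexpansive.
have marg i a : law P (fun w => tnth (xi k w) i) a = law P0 zeta a.
  by rewrite /law xiz.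
have var_fin x : \sum_a law P0 zeta a * enorm (Ti a x - T x) ^+ 2 <= sigma ^+ 2.
  have := var x.
  by rewrite (expectation_law P0 (fun a => enorm (Ti a x - T x) ^+ 2) mzeta)
    lee_fin.
have one_step x : \sum_s law P (xi k) s *
      enorm ((1 - alpha k) *: x + alpha k *: batch_op Ti s x - z) ^+ 2 <=
    enorm (x - z) ^+ 2 - alpha k * (1 - alpha k) * enorm (x - T x) ^+ 2
    + alpha k * ((b k)%:R^-1 * sigma ^+ 2).
  have ET : \sum_s law P (xi k) s *: batch_op Ti s x = T x.
    by rewrite TE (batch_op_mean Ti x bk (mxi k) marg).
  have := @relaxed_step_descent _ _ _ (law P (xi k))
    (fun s => batch_op Ti s x) (alpha k) ((b k)%:R^-1 * sigma ^+ 2) x z.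
  rewrite /= ET; apply => //.
  - by move=> s; exact: law_ge0.
  - exact: sum_law (mxi k).
  - have := batch_op_variance Ti x bk (mxi k) marg (sum_law P0 mzeta) (indb k).
    have pT : \sum_a law P0 zeta a *: Ti a x = T x by rewrite TE.
    rewrite /= pT => ->; apply: ler_wpM2l; last exact: var_fin.
    by rewrite invr_ge0.
rewrite (_ : _ * (_ / _) = alpha k * ((b k)%:R^-1 * sigma ^+ 2)); last by ring.
(* The constant noise term is spread over the histories, as 1 is their mass. *)
rewrite -[Y in _ <= _ + Y]mul1r.
rewrite -[Y in _ <= _ + Y * _](sum_law P (discrete_rv_history (k := k) mxi)).
rewrite mulr_suml mulr_sumr.
rewrite -sumrB -big_split/=.
rewrite (eq_bigr (fun hs => (law P (history xi k) hs.1 * law P (xi k) hs.2) *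
    enorm (X k.+1 hs - z) ^+ 2)); last first.
  by move=> [h s] _; rewrite law_history.
rewrite -(pair_bigA _ (fun h s => (law P (history xi k) h * law P (xi k) s) *
    enorm (X k.+1 (h, s) - z) ^+ 2))/=.
apply: ler_sum => h _; under eq_bigr do rewrite -mulrA.
rewrite -mulr_sumr.
apply: le_trans (ler_wpM2l (law_ge0 _ _ _) (one_step (X k h))) _.
by rewrite /X; lra.
Qed.

Theorem theorem3p2 (R : realType) (d n : nat)
    (Ti : 'I_n -> 'rV[R]_d -> 'rV[R]_d)
    (disp0 : measure_display) (Omega0 : measurableType disp0)
    (P0 : probability Omega0 R) (zeta : Omega0 -> 'I_n)
    (hzeta : discrete_rv zeta)
    (T : 'rV[R]_d -> 'rV[R]_d) (hT : forall x, T x = mean_op P0 zeta Ti x)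
    (hTi : forall i, nonexpansive (Ti i))
    (sigma : R) (sigma_ge0 : 0 <= sigma)
    (hsigma : forall x : 'rV[R]_d,
      ('E_P0[fun w => (enorm (Ti (zeta w) x - T x) ^+ 2)%R]
         <= (sigma ^+ 2)%:E)%E)
    (hFix : Fix T !=set0)
    (x0 : 'rV[R]_d) (alpha : nat -> R) (b : nat -> nat)
    (halpha : forall k, 0 < alpha k < 1) (hb : forall k, (1 <= b k)%N)
    (disp : measure_display) (Omega : measurableType disp)
    (P : probability Omega R)
    (xi : forall k, Omega -> (b k).-tuple 'I_n)
    (hxi : minibatch_sampling P0 zeta P xi)
    (x : nat -> Omega -> 'rV[R]_d)
    (hx : forall k w, x k w = minibatch_KM Ti x0 alpha xi k w)
    (hsum_alpha : (\sum_(0 <= k <oo) (alpha k * (1 - alpha k))%:E = +oo)%E)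
    (hsum_b : (\sum_(0 <= k <oo) ((Num.sqrt (b k)%:R)^-1)%:E < +oo :> \bar R)%E) :
  (forall xstar : 'rV[R]_d, Fix T xstar -> forall K : nat, (1 <= K)%N ->
    (\big[mine/+oo]_(0 <= k < K) expected_residual P T (x k)
     <= ((Num.sqrt (\sum_(0 <= k < K) alpha k * (1 - alpha k))%R)^-1)%:E
        * sqrte ((enorm (x0 - xstar) ^+ 2)%:E
                 + (sigma ^+ 2)%:E
                   * \sum_(0 <= k <oo) (alpha k / (b k)%:R)%:E))%E)
  /\
  ((fun K : nat =>
      fine (\big[mine/+oo%E]_(0 <= k < K) expected_residual P T (x k)) : R^o)
   =O_\oo
   (fun K : nat =>
      (Num.sqrt (\sum_(0 <= k < K) alpha k * (1 - alpha k)))^-1 : R^o)).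
Proof.
pose X j := @KM_of_history _ _ _ Ti x0 alpha b j.
have [mxi _ _ _] := hxi.
pose r k := \sum_h law P (history xi k) h * enorm (X k h - T (X k h)).
have resE k : expected_residual P T (x k) = (r k)%:E.
  rewrite -(expectation_law P (fun h => enorm (X k h - T (X k h))));
    last exact: discrete_rv_history.
  rewrite /expected_residual; congr ('E_P[_])%E; apply/funext => w.
  by rewrite hx minibatch_KM_history.
have r0 k : 0 <= r k.
  by rewrite sumr_ge0// => h _; rewrite mulr_ge0 ?law_ge0 ?sqrtr_ge0.
pose a k := alpha k * (1 - alpha k).
have a0 k : 0 < a k.
  by case/andP: (halpha k) => ? ?; rewrite mulr_gt0// subr_gt0.
have ab0 k : 0 <= alpha k / (b k)%:R.
  by case/andP: (halpha k) => /ltW ? _; rewrite divr_ge0.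
have bound xstar : Fix T xstar -> forall K : nat, (1 <= K)%N ->
    (\big[mine/+oo]_(0 <= k < K) expected_residual P T (x k)
     <= ((Num.sqrt (\sum_(0 <= k < K) alpha k * (1 - alpha k))%R)^-1)%:E
        * sqrte ((enorm (x0 - xstar) ^+ 2)%:E
                 + (sigma ^+ 2)%:E
                   * \sum_(0 <= k <oo) (alpha k / (b k)%:R)%:E))%E.
  move=> zfix K K1.
  pose e k := \sum_h law P (history xi k) h * enorm (X k h - xstar) ^+ 2.
  pose c k := sigma ^+ 2 * (alpha k / (b k)%:R).
  have e_ge0 k : 0 <= e k.
    by rewrite sumr_ge0// => h _; rewrite mulr_ge0 ?law_ge0 ?sqr_ge0.
  have step k : e k.+1 <= e k - a k * r k ^+ 2 + c k.
    have := KM_mean_descent x0 hzeta hT hTi hsigma zfix (halpha k) (hb k) hxi.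
    move=> /le_trans; apply; rewrite lerD2r lerD2l lerN2 ler_pM2l//.
    apply: jensen_sqr => [h|]; first exact: law_ge0.
    by apply: sum_law; exact: discrete_rv_history.
  have e0E : e 0 = enorm (x0 - xstar) ^+ 2.
    transitivity (\sum_h law P (history xi 0) h * enorm (x0 - xstar) ^+ 2).
      by [].
    by rewrite -mulr_suml sum_law ?mul1r//; exact: discrete_rv_history.
  have [k kK rk] := descent_small_residual K1 a0 e_ge0 step.
  apply: (@bigmin_inf_seq _ _ _ _ _ k) => //.
    by rewrite mem_index_iota.
  rewrite resE; apply: (@le_trans _ _ (_%:E)); first by rewrite lee_fin; exact: rk.
  rewrite EFinM; apply: lee_wpmul2l; first by rewrite lee_fin invr_ge0.
  have S_ge0 : (0 <= \sum_(0 <= k <oo) (alpha k / (b k)%:R)%:E)%E.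
    by apply: nneseries_ge0 => j _ _; rewrite lee_fin.
  rewrite -[leLHS]/(sqrte (_%:E)) lee_sqrt; last first.
    by rewrite adde_ge0 ?mule_ge0// lee_fin sqr_ge0.
  rewrite EFinD e0E leeD2l// -mulr_sumr EFinM lee_wpmul2l ?lee_fin ?sqr_ge0//.
  rewrite -sumEFin; apply: nneseries_lim_ge => j _ _.
  by rewrite lee_fin.
split=> //; have [z zfix] := hFix.
have fin_series : (\sum_(0 <= k <oo) (alpha k / (b k)%:R)%:E \is a fin_num)%E.
  rewrite ge0_fin_numE; last by apply: nneseries_ge0 => j _ _; rewrite lee_fin.
  apply: le_lt_trans hsum_b; apply: lee_nneseries => [j _ _|j _].
    by rewrite lee_fin.
  (* alpha_j / b_j <= 1 / b_j <= 1 / sqrt b_j, as b_j >= 1. *)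
  rewrite lee_fin; have b1 : 1 <= (b j)%:R :> R by rewrite ler1n.
  have sb : 1 <= Num.sqrt (b j)%:R :> R by rewrite -[leLHS]sqrtr1 ler_wsqrtr.
  apply: (@le_trans _ _ (b j)%:R^-1).
    by rewrite ler_piMl ?invr_ge0//; case/andP: (halpha j) => _ /ltW.
  rewrite lef_pV2 ?posrE ?(lt_le_trans ltr01)//.
  by rewrite -[leRHS](@sqr_sqrtr _ (b j)%:R)// expr2 ler_peMl ?sqrtr_ge0.
pose L := fine (\sum_(0 <= k <oo) (alpha k / (b k)%:R)%:E)%E.
pose C := Num.sqrt (enorm (x0 - z) ^+ 2 + sigma ^+ 2 * L).
(* C may vanish, whereas the constant of a big O is required positive. *)
apply/eqO_exP; exists (C + 1); first by rewrite ltr_wpDl ?sqrtr_ge0.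
near=> K.
(* At K = 0 the minimum over the empty range is +oo. *)
have K1 : (1 <= K)%N by near: K; exists 1%N.
have CE : sqrte ((enorm (x0 - z) ^+ 2)%:E + (sigma ^+ 2)%:E
    * \sum_(0 <= k <oo) (alpha k / (b k)%:R)%:E)%E = C%:E.
  by rewrite -(fineK fin_series).
have := bound z zfix K K1; rewrite CE -EFinM.
set m := \big[_/_]_(_ <= _ < _) _; set s := (Num.sqrt _)^-1.
have s0 : 0 <= s by rewrite invr_ge0 sqrtr_ge0.
have m0 : (0 <= m)%E.
  by apply: le_bigmin => // j _; rewrite resE lee_fin.
move=> mle.
have mfin : m \is a fin_num by rewrite ge0_fin_numE// (le_lt_trans mle) ?ltry.
rewrite [X in X <= _]ger0_norm ?fine_ge0// [X in _ <= _ * X]ger0_norm//.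
rewrite -lee_fin fineK//; apply: le_trans mle _.
by rewrite lee_fin mulrC ler_wpM2r// lerDl.
Unshelve. all: by end_near.
Qed.
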